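(* Set $$\phi:=(u_1,\ u_0)\,\operatorname{Im}\mathrm T\begin{pmatrix}u_1\\ u_0\end{pmatrix}$$ (where $(u_1,\ u_0)$ denotes the $1\times 2$ row vector with entries $u_1,u_0$) and $$\mathrm Z:=\overline{\mathrm T}+2i\phi^{-1}\operatorname{Im}\mathrm T\begin{pmatrix}u_1\\ u_0\end{pmatrix}(u_1,\ u_0)\operatorname{Im}\mathrm T.$$ Then the action of a monodromy $\gamma=\begin{pmatrix}A&B\\ C&D\end{pmatrix}\in\Gamma$ on $\mathrm Z$ is given by $\gamma\colon\mathrm Z\mapsto\gamma\mathrm Z=(A\mathrm Z+B)(C\mathrm Z+D)^{-1}$. Also, if we consider $z$ and $\phi\overline{w_{01}}$ as functions of $\mathrm Z$, then they satisfy $$z(\gamma\mathrm Z)=z(\mathrm Z),\qquad \phi(\gamma\mathrm Z)\overline{w_{01}(\gamma\mathrm Z)}=\det(C\mathrm Z+D)\phi(\mathrm Z)\overline{w_{01}(\mathrm Z)}.$$ Moreover, if the basis $u_0,u_1,u_2,u_3$ satisfies (i) $\det(\operatorname{Im}\mathrm T)<0$ (i.e., $\operatorname{Im}\mathrm T$ is indefinite) and (ii) $\operatorname{Im}(u_3\overline u_1+u_2\overline u_0)>0$, then $\mathrm Z$ is contained in the Siegel upper half-space $\mathbb H_2=\{\mathrm Z\in M_2(\mathbb C):{}^t\mathrm Z=\mathrm Z,\ \operatorname{Im}\mathrm Z>0\}$.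
   Context: Consider a fourth order Picard--Fuchs linear differential equation in the variable $z$ with projective monodromy group $\Gamma\subset\mathrm{Sp}_4(\mathbb R)$ commensurable with a discrete subgroup of $\mathrm{Sp}_4(\mathbb Z)$ and with a point of maximally unipotent monodromy. Let $u_0,u_1,u_2,u_3$ be a basis of solutions such that $W(u_0,u_2)+W(u_1,u_3)=0$ (where $W(f,g)=fg'-f'g$, $'=\mathrm d/\mathrm dz$) and the monodromy matrices $\gamma\in\Gamma$ act by left multiplication on the column vector $(u_3,u_2,u_1,u_0)^t$ (and on its derivative). Put $w_{jl}=C_0W(u_j,u_l)$ for a nonzero normalization constant $C_0$, in particular $w_{01}=C_0(u_0u_1'-u_0'u_1)$. Let $\mathrm T=\begin{pmatrix}u_3&u_3'\\ u_2&u_2'\end{pmatrix}\begin{pmatrix}u_1&u_1'\\ u_0&u_0'\end{pmatrix}^{-1}=\begin{pmatrix}\tau_1&\tau_2\\ \tau_2&\tau_3\end{pmatrix}$, a symmetric matrix with $\tau_1=w_{03}/w_{01}$, $\tau_2=w_{02}/w_{01}$, $\tau_3=-w_{12}/w_{01}$; it satisfies $\mathrm T(u_1,u_0)^t=(u_3,u_2)^t$, and under $\gamma=\begin{pmatrix}A&B\\ C&D\end{pmatrix}\in\Gamma$ it transforms as $\mathrm T\mapsto(A\mathrm T+B)(C\mathrm T+D)^{-1}$, while $w_{01}\mapsto\det(C\mathrm T+D)w_{01}$ and $z$ is invariant. *)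

(* Defs.v *)
From HB Require Import structures.
From mathcomp Require Import all_boot all_order all_algebra.
From mathcomp Require Import complex.
From mathcomp Require Import all_classical all_reals all_analysis.

Set Implicit Arguments.
Unset Strict Implicit.
Unset Printing Implicit Defensive.

Import Order.TTheory GRing.Theory Num.Theory.
Import numFieldNormedType.Exports.

Local Open Scope classical_set_scope.
Local Open Scope ring_scope.

(* The annotation makes the norm topology available on R[i], so that derive1
   and derivable on Cx R -> Cx R are the complex derivative. *)
Definition Cx (R : realType) : numClosedFieldType := R[i].

Definition Jmx (K : pzRingType) : 'M[K]_(2 + 2) :=
  block_mx 0 1%:M (- 1%:M) 0.

Definition Sp4 (K : comPzRingType) : set 'M[K]_(2 + 2) :=
  [set g | g^T *m Jmx K *m g = Jmx K].

Section MatrixGroups.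
Variables (K : comUnitRingType) (n : nat).
Implicit Types G H : set 'M[K]_n.

Definition matrix_group G : Prop :=
  [/\ G `<=` [set g | g \in unitmx],
      G 1%:M,
      forall g h, G g -> G h -> G (g *m h) &
      forall g, G g -> G (invmx g)].

Definition finite_index H G : Prop :=
  H `<=` G /\
  exists s : seq 'M[K]_n,
    forall g, G g -> exists r h, [/\ r \in s, H h & g = r *m h].

Definition commensurable G H : Prop :=
  finite_index (G `&` H) G /\ finite_index (G `&` H) H.

End MatrixGroups.

Section Equation.
Variable R : realType.
Local Notation C := (Cx R).

Definition toC m n (M : 'M[R]_(m, n)) : 'M[C]_(m, n) :=
  map_mx (real_complex R) M.

Definition Immx m n (M : 'M[C]_(m, n)) : 'M[R]_(m, n) :=
  map_mx (@complex.Im R) M.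

Definition conjmx m n (M : 'M[C]_(m, n)) : 'M[C]_(m, n) :=
  map_mx (fun z : C => z^*) M.

(* The equation a_4 y'''' + a_3 y''' + a_2 y'' + a_1 y' + a_0 y = 0. *)
Variable a : 'I_5 -> {poly C}.

Definition regular_pt (x : C) : Prop := (a ord_max).[x] != 0.

(* Fuchs' criterion: a_(4-k) / a_4 has a pole of order at most k at every
   finite point and is O(z^(-k)) at infinity. *)
Definition fuchsian : Prop :=
  a ord_max != 0 /\
  forall i : 'I_5, a i != 0 ->
    (forall s : C, (mup s (a ord_max) <= mup s (a i) + (4 - i))%N) /\
    (size (a i) + (4 - i) <= size (a ord_max))%N.

Definition solution (x : C) (f : C -> C) : Prop :=
  \forall z \near x,
    (forall k, (k < 4)%N -> derivable (derive1n k f : C -> C) z 1) /\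
    \sum_(k < 5) (a k).[z] * derive1n k f z = 0.

(* Four functions u_0, ..., u_3, of which only the germs at some point matter;
   the numerals 0, 1, 2, 3 below are read in 'I_4. *)
Definition frame := 'I_4 -> C -> C.

Definition germ_eq (x : C) (f g : frame) : Prop :=
  forall j, \forall z \near x, f j z = g j z.

Definition basis_of_solutions (x : C) (u : frame) : Prop :=
  [/\ forall j, solution x (u j),
      forall k : 'I_4 -> C,
        (\forall z \near x, \sum_j k j * u j z = 0) -> forall j, k j = 0 &
      forall f, solution x f ->
        exists k : 'I_4 -> C, \forall z \near x, f z = \sum_j k j * u j z].

(* Analytic continuation along c : [0, 1] -> C, avoiding the zeros of a_4: F t
   represents the germ at c t, and nearby members of F agree. *)
Definition continuation (c : R -> C) (f g : frame) : Prop :=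
  [/\ {within `[0, 1], continuous c},
      forall t : R, t \in `[0, 1] -> regular_pt (c t) &
      exists F : R -> frame,
      [/\ forall t : R, t \in `[0, 1] -> forall j, solution (c t) (F t j),
          forall t : R, t \in `[0, 1] ->
            \forall s \near t, s \in `[0, 1] -> germ_eq (c s) (F s) (F t),
          germ_eq (c 0) (F 0) f &
          germ_eq (c 1) (F 1) g]].

Definition col4 (v : frame) (x : C) : 'cV[C]_(2 + 2) :=
  \col_i v (rev_ord i) x.

(* The frame v' with (v'_3, v'_2, v'_1, v'_0)^t = M (v_3, v_2, v_1, v_0)^t. *)
Definition act (M : 'M[C]_(2 + 2)) (v : frame) : frame :=
  fun j x => (M *m col4 v x) (rev_ord j) 0.

Definition monodromy (z0 : C) (u : frame) : set 'M[C]_(2 + 2) :=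
  [set M | exists l : R -> C,
    [/\ l 0 = z0, l 1 = z0 & continuation l u (act M u)]].

Definition Gamma (z0 : C) (u : frame) : set 'M[R]_(2 + 2) :=
  [set g | monodromy z0 u (toC g)].

(* All branches of the multivalued frame u: the pairs (x, v) with v the germ
   at x of a continuation of u along some path from z0 to x. *)
Definition branches (z0 : C) (u : frame) : set (C * frame) :=
  [set p | exists c : R -> C,
    [/\ c 0 = z0, c 1 = p.1 & continuation c u p.2]].

Definition circle (s x : C) (t : R) : C :=
  s + (x - s) * ((cos (2 * pi * t))%:C + 'i%C * (sin (2 * pi * t))%:C)%C.

Definition maximally_unipotent (M : 'M[C]_(2 + 2)) : Prop :=
  let N := M - 1%:M in
  N *m N *m N *m N = 0 /\ N *m N *m N != 0.

(* The second alternative is the point at infinity. *)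
Definition has_MUM_point (z0 : C) (u : frame) : Prop :=
  exists s x v M,
    [/\ branches z0 u (x, v),
        continuation (circle s x) v (act M v),
        maximally_unipotent M &
        [/\ root (a ord_max) s, x != s &
            forall s', root (a ord_max) s' -> `|s' - s| <= `|x - s| -> s' = s]
        \/ (s = 0 /\ forall s', root (a ord_max) s' -> `|s'| < `|x|)].

Definition W (f g : C -> C) (x : C) : C :=
  f x * derive1 g x - derive1 f x * g x.

Definition w (C0 : C) (v : frame) (j l : 'I_4) (x : C) : C :=
  C0 * W (v j) (v l) x.

Definition mx2 (p q r s : C) : 'M[C]_2 :=
  \matrix_(i, j) nth 0 (nth [::] [:: [:: p; q]; [:: r; s]] i) j.

Definition Tmx (v : frame) (x : C) : 'M[C]_2 :=
  mx2 (v 3 x) (derive1 (v 3) x)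
      (v 2 x) (derive1 (v 2) x) *m
  invmx (mx2 (v 1 x) (derive1 (v 1) x)
             (v 0 x) (derive1 (v 0) x)).

Definition col2 (v : frame) (x : C) : 'cV[C]_2 :=
  \col_i [:: v 1 x; v 0 x]`_i.

Definition phi (v : frame) (x : C) : C :=
  ((col2 v x)^T *m toC (Immx (Tmx v x)) *m col2 v x) 0 0.

Definition Zmx (v : frame) (x : C) : 'M[C]_2 :=
  conjmx (Tmx v x) +
  (2 * 'i%C * (phi v x)^-1) *:
    (toC (Immx (Tmx v x)) *m col2 v x *m (col2 v x)^T *m
     toC (Immx (Tmx v x))).

(* T exists at (x, v) when w_01 does not vanish; Z moreover needs phi^-1. *)
Definition Z_defined (C0 : C) (v : frame) (x : C) : Prop :=
  w C0 v 0 1 x != 0 /\ phi v x != 0.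

Definition cocycle (c d : 'M[R]_2) (Z : 'M[C]_2) : 'M[C]_2 :=
  toC c *m Z + toC d.

Definition siegel_act (a' b c d : 'M[R]_2) (Z : 'M[C]_2) : 'M[C]_2 :=
  (toC a' *m Z + toC b) *m invmx (cocycle c d Z).

Definition siegel_half_space : set 'M[C]_2 :=
  [set Z | Z^T = Z /\
    forall y : 'cV[R]_2, y != 0 -> 0 < (y^T *m Immx Z *m y) 0 0].

End Equation.

(* Main.v *)
Require Import Defs.
From HB Require Import structures.
From mathcomp Require Import all_boot all_order all_algebra.
From mathcomp Require Import complex ring lra.
From mathcomp Require Import all_classical all_reals all_analysis.
Import Order.TTheory GRing.Theory Num.Theory.
Import numFieldNormedType.Exports.
Local Open Scope classical_set_scope.
Local Open Scope ring_scope.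

(** The matrix [Z] is characterised by [Z u = T u] and [Z y = conj T y] for the
    [y] with [u^T (Im T) y = 0], where [u = (u_1, u_0)^t]: it is a rank one
    perturbation of [conj T].  Since [gamma] is real and symplectic, it maps
    [u] to [J u] with [J = C T + D], [Im T] to [(conj J)^-T (Im T) J^-1] and
    [conj T] by the same Moebius formula as [T], which gives the action on [Z];
    the rank one determinant formula gives
    [phi * det (C Z + D) = phi(gamma Z) * conj (det J)].
    For the positivity, write [u = p + i q], let [b] be the indefinite bilinear
    form of [Im T] and [h = b p p + b q q > 0].  The vanishing of the Gram
    determinant of [p, q, y] turns [|phi|^2 * y^T (Im Z) y] into
    [h * (2 * (b p y ^ 2 + b q y ^ 2) - h * b y y)], which reversed
    Cauchy-Schwarz makes positive. *)

(** * Rank one updates and the symplectic action *)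

(** Both sides are the determinant of the block matrix with rows [(1, - y)] and [(x, 1)], factored
    through its two Schur complements. *)
Lemma det_1D_rank1 (K : comPzRingType) n (x : 'cV[K]_n) (y : 'rV[K]_n) :
  \det (1%:M + x *m y) = 1 + (y *m x) 0 0.
Proof.
have -> : 1 + (y *m x) 0 0 = \det (1%:M + y *m x).
  by rewrite det_mx11 !mxE.
transitivity (\det (block_mx 1%:M (- y) x 1%:M)).
  have -> : block_mx 1%:M (- y) x 1%:M =
      block_mx 1%:M 0 x 1%:M *m block_mx 1%:M (- y) 0 (1%:M + x *m y).
    rewrite mulmx_block ?(mul1mx, mulmx1, mul0mx, mulmx0, addr0) mulmxN.
    by rewrite [1%:M + _]addrC addKr.
  by rewrite det_mulmx det_lblock det_ublock !det1 !mul1r.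
have -> : block_mx 1%:M (- y) x 1%:M =
    block_mx (1%:M + y *m x) (- y) 0 1%:M *m block_mx 1%:M 0 x 1%:M.
  rewrite mulmx_block ?(mul1mx, mulmx1, mul0mx, mulmx0, add0r) mulNmx.
  by rewrite addrK.
by rewrite det_mulmx det_lblock det_ublock !det1 !mulr1.
Qed.

Section SymplecticAction.
Variables (K : fieldType) (n : nat) (A B C D : 'M[K]_n).
Hypotheses (hAC : A^T *m C = C^T *m A) (hBD : B^T *m D = D^T *m B)
  (hAD : A^T *m D - C^T *m B = 1%:M).

(** The symplectic pairing of the block columns [(S; 1)] and [(T; 1)] is [S^T - T], and it is
    unchanged when the symplectic matrix acts on both. *)
Lemma symplectic_cross (S T : 'M[K]_n) : S^T = S ->
  (A *m S + B)^T *m (C *m T + D) - (C *m S + D)^T *m (A *m T + B) = S - T.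
Proof.
move=> hS.
have hDA : D^T *m A - B^T *m C = 1%:M.
  by rewrite -(trmx1 K n) -hAD linearB/= !trmx_mul !trmxK.
rewrite !linearD/= !trmx_mul hS !mulmxDl ?mulmxDr.
rewrite -!mulmxA hBD [A^T *m (C *m T)]mulmxA hAC.
rewrite -[S in RHS]mulmx1 -hAD -[T in RHS]mul1mx -hDA mulmxBr mulmxBl.
by apply/matrixP=> i j; rewrite -!mulmxA !mxE; ring.
Qed.

(** Transpose of the invariant pairing of [(1; 0)] with [(S; 1)]. If [A S + B = S' (C S + D)] with
    [S'] symmetric, it exhibits [A - S' C] as the inverse of [(C S + D)^T]. *)
Lemma symplectic_left (S : 'M[K]_n) : S^T = S ->
  (C *m S + D)^T *m A - (A *m S + B)^T *m C = 1%:M.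
Proof.
move=> hS.
have hDA : D^T *m A - B^T *m C = 1%:M.
  by rewrite -(trmx1 K n) -hAD linearB/= !trmx_mul !trmxK.
rewrite !linearD/= !trmx_mul hS !mulmxDl -!mulmxA hAC opprD addrACA subrr.
by rewrite add0r.
Qed.

(** Pairing [T] with itself gives [J^T T'^T J = J^T T' J] for [J = C T + D], and [J] cancels on both
    sides. *)
Lemma moebius_sym (T T' : 'M[K]_n) : T^T = T -> C *m T + D \in unitmx ->
  T' *m (C *m T + D) = A *m T + B -> T'^T = T'.
Proof.
move=> hT hJ hT'; have := symplectic_cross T T hT.
rewrite subrr -hT' trmx_mul mulmxA => /eqP; rewrite subr_eq0 => /eqP.
move=> /(congr1 (mulmx^~ (invmx (C *m T + D)))); rewrite !mulmxK//.
have hJ' : (C *m T + D)^T \in unitmx by rewrite unitmx_tr.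
by move=> /(congr1 (mulmx (invmx (C *m T + D)^T))); rewrite !mulKmx.
Qed.

(** [Tb], [Jb], [Tb'] stand for the conjugates of [T], [J], [T'], while [Y] is [Im T] and [c] is
    [2i]. Conjugation enters only through the algebraic relations below, so the computation runs
    over any field. *)
Variables (c : K) (T Tb Y T' Tb' Y' : 'M[K]_n) (u u' : 'cV[K]_n).
Let J := C *m T + D.
Let Jb := C *m Tb + D.
Hypotheses (hc : c != 0) (hT : T^T = T) (hTb : Tb^T = Tb)
  (hJ : J \in unitmx) (hJb : Jb \in unitmx)
  (hT' : T' *m J = A *m T + B) (hTb' : Tb' *m Jb = A *m Tb + B)
  (hY : T - Tb = c *: Y) (hY' : T' - Tb' = c *: Y') (hu : u' = J *m u).

Let sym_of_diff (S Sb X : 'M[K]_n) : S^T = S -> Sb^T = Sb ->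
  S - Sb = c *: X -> X^T = X.
Proof.
move=> hS hSb hX; apply: (scalerI hc).
by rewrite -hX -linearZ/= -hX linearB/= hS hSb.
Qed.

Let symY : Y^T = Y. Proof. exact: (sym_of_diff _ _ _ hT hTb hY). Qed.

Let symT' : T'^T = T'. Proof. exact: (moebius_sym _ _ hT hJ hT'). Qed.

Let symTb' : Tb'^T = Tb'. Proof. exact: (moebius_sym _ _ hTb hJb hTb'). Qed.

Let symY' : Y'^T = Y'. Proof. exact: (sym_of_diff _ _ _ symT' symTb' hY'). Qed.

(** In [symplectic_cross] for [Tb] and [T], the left side becomes [Jb^T (Tb' - T') J]; dividing by
    [- c] gives the claim. *)
Lemma moebius_im : Jb^T *m Y' *m J = Y.
Proof.
apply: (scalerI hc); rewrite -hY scalemxAl scalemxAr -hY'.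
rewrite mulmxBr mulmxBl -mulmxA hT' -[T - Tb]opprB.
by rewrite -(symplectic_cross Tb T hTb) -hTb' trmx_mul symTb' opprB.
Qed.

Let phi := (u^T *m Y *m u) 0 0.
Let phi' := (u'^T *m Y' *m u') 0 0.
Let Z := Tb + (c * phi^-1) *: (Y *m u *m u^T *m Y).
Let Z' := Tb' + (c * phi'^-1) *: (Y' *m u' *m u'^T *m Y').
Hypotheses (phi0 : phi != 0) (phi'0 : phi' != 0).
Let r := u^T *m Y.
Let r' := u'^T *m Y'.

Let col_im : Jb^T *m (Y' *m u') = Y *m u.
Proof. by rewrite hu !mulmxA moebius_im. Qed.

Let row_im : r' *m Jb = r.
Proof.
rewrite -[LHS]trmxK [(r' *m Jb)^T]trmx_mul [r'^T]trmx_mul trmxK symY' col_im.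
by rewrite trmx_mul symY.
Qed.

Let k := r' *m (C *m Y *m u).

(** Since [r = r' Jb] and [u' = J u], the difference [phi' - phi] is [r' (J - Jb) u], and
    [J - Jb = c C Y]. *)
Let ck : c * k 0 0 = phi' - phi.
Proof.
have <- : (c *: k) 0 0 = c * k 0 0 by rewrite mxE.
have -> : c *: k = r' *m u' - r *m u.
  rewrite [in r' *m u']hu -row_im /k scalemxAr -[r' *m Jb *m u]mulmxA.
  rewrite -mulmxBr; congr (_ *m _).
  rewrite -mulmxBl scalemxAl; congr (_ *m _).
  by rewrite /J /Jb opprD addrACA subrr addr0 -mulmxBr hY -scalemxAr.
by rewrite mxE [in X in _ + X]mxE.
Qed.

Let cocycleE : C *m Z + D = Jb + (c * phi^-1) *: (C *m Y *m u *m r).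
Proof. by rewrite /Z mulmxDr -scalemxAr addrAC !mulmxA. Qed.

(** As [r = r' Jb], the factor [Jb] splits off on the right of [C Z + D]. What remains is a rank one
    update of the identity, of determinant [1 + c k / phi = phi' / phi]. *)
Lemma det_cocycle_mod : phi * \det (C *m Z + D) = phi' * \det Jb.
Proof.
have -> : C *m Z + D =
    (1%:M + ((c * phi^-1) *: (C *m Y *m u)) *m r') *m Jb.
  by rewrite cocycleE mulmxDl mul1mx -!scalemxAl -[_ *m r' *m Jb]mulmxA row_im.
rewrite det_mulmx det_1D_rank1 -scalemxAr mxE -/k mulrA; congr (_ * _).
by rewrite mulrAC ck mulrDr mulr1 mulrCA divff// mulr1 subrKC.
Qed.

(** Stated without an inverse: the invertibility of [C Z + D] is deduced later from the determinant
    formula. *)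
Lemma moebius_mod : Z' *m (C *m Z + D) = A *m Z + B.
Proof.
have rowZ : r' *m (C *m Z + D) = (phi' * phi^-1) *: r.
  rewrite cocycleE mulmxDr row_im -scalemxAr mulmxA -/k.
  rewrite [k]mx11_scalar mul_scalar_mx scalerA mulrAC ck.
  by rewrite mulrBl divff// scalerBl scale1r subrKC.
(* [A - Tb' C] is the inverse of [Jb^T], so this inverts [col_im]. *)
have colY : Y' *m u' = (A - Tb' *m C) *m (Y *m u).
  have hJbT : Jb^T \in unitmx by rewrite unitmx_tr.
  rewrite -[LHS](mulKmx hJbT) col_im; congr (_ *m _).
  rewrite -[RHS](mulKmx hJbT) mulmxBr mulmxA -[in X in _ - X]symTb'.
  by rewrite -trmx_mul hTb' symplectic_left// mulmx1.
rewrite mulmxDl -scalemxAl -(mulmxA (Y' *m u')) -(mulmxA (Y' *m u')).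
rewrite rowZ -scalemxAr scalerA colY cocycleE mulmxDr hTb' mulmxDr.
rewrite -!scalemxAr -addrA [RHS]addrAC; congr (_ + _).
rewrite -[c * _ * _]mulrA mulKf//.
rewrite -scalerDr; congr (_ *: _).
by rewrite !mulmxA -!mulmxDl subrKC -!mulmxA.
Qed.
End SymplecticAction.

(** * Indefinite binary forms *)

Section IndefiniteBinaryForm.
Variables (R : realFieldType) (m1 m2 m3 : R).
Let b (x1 x2 y1 y2 : R) :=
  m1 * x1 * y1 + m2 * (x1 * y2 + x2 * y1) + m3 * x2 * y2.
Hypothesis indef : m1 * m3 - m2 ^+ 2 < 0.
Variables (p1 p2 q1 q2 : R).
Let al := b p1 p2 p1 p2.
Let be := b p1 p2 q1 q2.
Let ga := b q1 q2 q1 q2.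
Hypothesis pos : 0 < al + ga.

(** Reversed Cauchy-Schwarz: the Gram determinant is the negative discriminant [m1 m3 - m2^2] times
    the square of the area spanned by [x] and [y]. *)
Lemma gram_le0 x1 x2 y1 y2 :
  b x1 x2 x1 x2 * b y1 y2 y1 y2 <= b x1 x2 y1 y2 ^+ 2.
Proof.
rewrite -subr_le0.
have -> : b x1 x2 x1 x2 * b y1 y2 y1 y2 - b x1 x2 y1 y2 ^+ 2 =
  (m1 * m3 - m2 ^+ 2) * (x1 * y2 - x2 * y1) ^+ 2 by rewrite /b; ring.
by rewrite nmulr_rle0// sqr_ge0.
Qed.

(** For [u = p + i q] this quantity is [|phi|^2]. It equals [(al + ga)^2 + 4 (be^2 - al ga)], whose
    last term is nonnegative by [gram_le0]; hence [phi] does not vanish. *)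
Lemma phi_norm_gt0 : 0 < (al - ga) ^+ 2 + (2 * be) ^+ 2.
Proof.
have := gram_le0 p1 p2 q1 q2; rewrite -/al -/be -/ga => h.
have : 0 < (al + ga) ^+ 2 by rewrite exprn_gt0.
nra.
Qed.

(* The three vectors lie in a plane, so their Gram determinant vanishes; this
   turns the right-hand side into
   [(al + ga) * (2 * (a ^+ 2 + d ^+ 2) - e * (al + ga))]. *)
Lemma modified_im_gt0 y1 y2 (a := b p1 p2 y1 y2) (d := b q1 q2 y1 y2)
    (e := b y1 y2 y1 y2) : (y1 != 0) || (y2 != 0) ->
  0 < 2 * ((a ^+ 2 - d ^+ 2) * (al - ga) + 2 * a * d * (2 * be))
      - e * ((al - ga) ^+ 2 + (2 * be) ^+ 2).
Proof.
move=> y0.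
have -> : 2 * ((a ^+ 2 - d ^+ 2) * (al - ga) + 2 * a * d * (2 * be))
      - e * ((al - ga) ^+ 2 + (2 * be) ^+ 2) =
    (al + ga) * (2 * (a ^+ 2 + d ^+ 2) - e * (al + ga)).
  by rewrite /a /d /e /al /be /ga /b; ring.
rewrite mulr_gt0// subr_gt0.
have hp := gram_le0 p1 p2 y1 y2; have hq := gram_le0 q1 q2 y1 y2.
rewrite -/al -/ga -/a -/d -/e in hp hq.
have a2 := sqr_ge0 a; have d2 := sqr_ge0 d.
(* Adding [hp] and [hq] gives [e (al + ga) <= a^2 + d^2], which is the weak inequality. Equality
   forces [a = d = 0], then [e = 0]. *)
rewrite lt_neqAle; apply/andP; split; last by nra.
apply/negP => /eqP eq0.
have aE0 : a ^+ 2 = 0 by nra.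
have dE0 : d ^+ 2 = 0 by nra.
have e0 : e = 0.
  have /eqP : e * (al + ga) = 0 by rewrite eq0 aE0 dE0 addr0 mulr0.
  by rewrite mulf_eq0 (gt_eqF pos) orbF => /eqP.
(* With [e = 0] the Gram identity makes any vector orthogonal to [y] collinear with [y]. So [p] and
   [q] are multiples of an isotropic vector, and [al + ga = 0], a contradiction. *)
have colin x1 x2 : b x1 x2 y1 y2 ^+ 2 = 0 -> x1 * y2 - x2 * y1 = 0.
  move=> h; have : (m1 * m3 - m2 ^+ 2) * (x1 * y2 - x2 * y1) ^+ 2 = 0.
    transitivity (b x1 x2 x1 x2 * e - b x1 x2 y1 y2 ^+ 2).
      by rewrite /e /b; ring.
    by rewrite e0 h mulr0 subr0.
  by move=> /eqP; rewrite mulf_eq0 (lt_eqF indef)/= sqrf_eq0 => /eqP.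
have hpy := colin _ _ aE0; have hqy := colin _ _ dE0.
have iso x1 x2 : x1 * y2 - x2 * y1 = 0 -> b x1 x2 x1 x2 = 0.
  move=> h; case/orP: y0 => y0.
    have -> : x2 = x1 / y1 * y2 by rewrite mulrAC (subr0_eq h) mulfK.
    have -> : b x1 (x1 / y1 * y2) x1 (x1 / y1 * y2) = (x1 / y1) ^+ 2 * e.
      by rewrite /e /b; field.
    by rewrite e0 mulr0.
  have -> : x1 = x2 / y2 * y1 by rewrite mulrAC -(subr0_eq h) mulfK.
  have -> : b (x2 / y2 * y1) x2 (x2 / y2 * y1) x2 = (x2 / y2) ^+ 2 * e.
    by rewrite /e /b; field.
  by rewrite e0 mulr0.
by move: pos; rewrite /al /ga (iso _ _ hpy) (iso _ _ hqy) addr0 ltxx.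
Qed.

End IndefiniteBinaryForm.

(** * Conjugates and imaginary parts of complex matrices *)

Section ComplexMatrices.
Variable R : realType.
Local Notation C := (Cx R).
Local Notation conjmx := Defs.conjmx.

Lemma conjmxE m n (M : 'M[C]_(m, n)) : conjmx M = map_mx (@Num.conj C) M.
Proof. by []. Qed.

Lemma toC_inj m n : injective (@toC R m n).
Proof.
move=> M N /matrixP h; apply/matrixP => i j.
by have := h i j; rewrite !mxE => -[].
Qed.

Lemma conjmx_toC m n (M : 'M[R]_(m, n)) : conjmx (toC M) = toC M.
Proof.
apply/matrixP=> i j; rewrite !mxE; apply/eqP.
by rewrite eq_complex /= oppr0 !eqxx.
Qed.

Lemma sub_conjmx m n (M : 'M[C]_(m, n)) :
  M - conjmx M = (2 * 'i%C) *: toC (Immx M).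
Proof.
apply/matrixP=> i j; rewrite !mxE; case: (M i j) => p q.
apply/eqP; rewrite eq_complex /=; apply/andP; split; apply/eqP; simpc; ring.
Qed.

Lemma det_mx22 (K : comPzRingType) (M : 'M[K]_2) :
  \det M = M 0 0 * M 1 1 - M 0 1 * M 1 0.
Proof.
rewrite (expand_det_row _ 0) !big_ord_recl big_ord0 /cofactor !det_mx11 !mxE /=.
have -> : lift 0 (0 : 'I_1) = 1 :> 'I_2 by apply: val_inj.
have -> : lift 1 (0 : 'I_1) = 0 :> 'I_2 by apply: val_inj.
by rewrite /= expr0 addr0 mul1r expr1 mulN1r mulrN.
Qed.

End ComplexMatrices.

Lemma big_ord2 (K : nmodType) (F : 'I_2 -> K) : \sum_i F i = F 0 + F 1.
Proof.
by rewrite !big_ord_recl big_ord0 addr0; congr (_ + F _); apply: val_inj.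
Qed.

Lemma ord2P (k : 'I_2) : k = 0 \/ k = 1.
Proof. by case: k => [[|[|//]] ?]; [left|right]; apply: val_inj. Qed.

Lemma eq_mx22 (K : Type) (M N : 'M[K]_2) : M 0 0 = N 0 0 -> M 0 1 = N 0 1 ->
  M 1 0 = N 1 0 -> M 1 1 = N 1 1 -> M = N.
Proof.
move=> h1 h2 h3 h4; apply/matrixP => i j.
by case: (ord2P i) => ->; case: (ord2P j) => ->.
Qed.

(** * Symmetry and positivity of [Z] at one point of one branch *)

Section Pointwise.
Variable R : realType.
Local Notation C := (Cx R).
Local Notation conjmx := Defs.conjmx.
Variables (v : frame R) (x : C).
Local Notation T := (Tmx v x).
Hypothesis symT : T^T = T.

Lemma Immx_tr m n (M : 'M[C]_(m, n)) : (Immx M)^T = Immx M^T.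
Proof. by rewrite /Immx map_trmx. Qed.

Lemma Zmx_sym : (Zmx v x)^T = Zmx v x.
Proof.
have symY : (toC (Immx T))^T = toC (Immx T).
  by rewrite /toC map_trmx Immx_tr symT.
rewrite /Zmx linearD linearZ/= /Defs.conjmx map_trmx symT.
by rewrite !trmx_mul trmxK symY !mulmxA.
Qed.

Lemma Zmx_siegel : T *m col2 v x = \col_i [:: v 3 x; v 2 x]`_i ->
  \det (Immx T) < 0 ->
  0 < complex.Im (v 3 x * (v 1 x)^* + v 2 x * (v 0 x)^*) ->
  siegel_half_space (Zmx v x).
Proof.
move=> hcol; rewrite det_mx22 => indef pos; split; first exact: Zmx_sym.
(* [T] and [f = phi] become variables, remembered only through the symmetry of [T], its value on
   [(u_1, u_0)^t], the two inequalities and the equation defining [f]. *)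
rewrite /Zmx; set f := phi v x; have := erefl f; rewrite {2}/f /phi.
move: (f) (Tmx v x) symT hcol indef pos => {}f T hsym hcol indef pos.
have T10 : T 1 0 = T 0 1 by rewrite -[in LHS]hsym mxE.
move/matrixP: hcol => hcol.
have := hcol 0 0; have := hcol 1 0.
rewrite !mxE !big_ord2 /= !mxE /= T10 => h2 h3 fE.
move: pos; rewrite -h2 -h3 => {h2 h3 hcol}.
case u1E : (v 1 x) => [p1 q1]; case u0E : (v 0 x) => [p2 q2].
case T00E : (T 0 0) => [x1 m1]; case T01E : (T 0 1) => [x2 m2].
case T11E : (T 1 1) => [x3 m3].
have := indef; rewrite !mxE T10 T00E T01E T11E /= -expr2 => {}indef pos.
pose b x1 x2 y1 y2 := m1 * x1 * y1 + m2 * (x1 * y2 + x2 * y1) + m3 * x2 * y2.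
(* By symmetry of [Re T], the imaginary part of the Hermitian expression in [T] and [u] is the value
   of [Im T] on [u], that is [b p p + b q q]. *)
have {}pos : 0 < b p1 p2 p1 p2 + b q1 q2 q1 q2.
  by move: pos; congr (_ < _); rewrite /b; simpc => /=; ring.
have {}fE : f = Complex (b p1 p2 p1 p2 - b q1 q2 q1 q2) (2 * b p1 p2 q1 q2).
  rewrite fE !(mxE, big_ord2) /= T10 T00E T01E T11E u1E u0E.
  apply/eqP; rewrite eq_complex /=.
  by apply/andP; split; apply/eqP; rewrite /b; ring.
have nrm := @phi_norm_gt0 _ _ _ _ indef p1 p2 q1 q2 pos.
rewrite -!/(b _ _ _ _) in nrm.
move=> y y0.
have {}y0 : (y 0 0 != 0) || (y 1 0 != 0).
  apply: contraR y0; rewrite negb_or !negbK => /andP[/eqP y00 /eqP y10].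
  apply/eqP/matrixP => i j; rewrite [j]ord1 mxE.
  by case: (ord2P i) => ->.
have := @modified_im_gt0 _ _ _ _ indef p1 p2 q1 q2 pos (y 0 0) (y 1 0) y0.
rewrite -!/(b _ _ _ _).
set N := _ ^+ 2 + _ ^+ 2 in nrm *; move=> h.
set M := Immx _.
suff -> : (y^T *m M *m y) 0 0 =
  (2 * ((b p1 p2 (y 0 0) (y 1 0) ^+ 2 - b q1 q2 (y 0 0) (y 1 0) ^+ 2) *
      (b p1 p2 p1 p2 - b q1 q2 q1 q2) +
      2 * b p1 p2 (y 0 0) (y 1 0) * b q1 q2 (y 0 0) (y 1 0) *
      (2 * b p1 p2 q1 q2)) - b (y 0 0) (y 1 0) (y 0 0) (y 1 0) * N) / N.
  exact: divr_gt0.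
(* [P] and [Q] are the real and imaginary parts of [(Im T) u]; pairing them with [y] yields [b p y]
   and [b q y]. *)
pose P (i : 'I_2) := [:: m1 * p1 + m2 * p2; m2 * p1 + m3 * p2]`_i.
pose Q (i : 'I_2) := [:: m1 * q1 + m2 * q2; m2 * q1 + m3 * q2]`_i.
have rE : toC (Immx T) *m col2 v x = \col_i Complex (P i) (Q i) :> 'cV[C]_2.
  apply/matrixP=> i j; rewrite !(mxE, big_ord2) /= u1E u0E.
  apply/eqP; rewrite eq_complex /=.
  by case: (ord2P i) => ->; rewrite ?T10 ?T00E ?T01E ?T11E /P /Q /=;
    apply/andP; split; apply/eqP; ring.
have fV : f^-1 = Complex ((b p1 p2 p1 p2 - b q1 q2 q1 q2) / N)
                         (- (2 * b p1 p2 q1 q2 / N)).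
  by rewrite fE.
(* The imaginary part of [2i s] is [2 Re s], here with [s = r_i r_j / phi], [r = P + i Q], and
   [1 / phi = conj phi / N] for [N = |phi|^2]. *)
have ME i j : M i j = - complex.Im (T i j) + 2 *
    ((P i * P j - Q i * Q j) * (b p1 p2 p1 p2 - b q1 q2 q1 q2) +
     (P i * Q j + Q i * P j) * (2 * b p1 p2 q1 q2)) / N.
  rewrite /M -[_ *m toC (Immx T)]mulmxA.
  have -> : (col2 v x)^T *m toC (Immx T) = (toC (Immx T) *m col2 v x)^T.
    by rewrite trmx_mul /toC map_trmx Immx_tr hsym.
  rewrite rE fV !(mxE, big_ord1).
  move: (P i) (P j) (Q i) (Q j) (T i j) (N^-1) => Pi Pj Qi Qj [xx yy] Ni.
  by simpc; rewrite /=; ring.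
clearbody M; rewrite !(mxE, big_ord2) !ME T10 T00E T01E T11E /P /Q /=.
rewrite [RHS]mulrBl mulfK ?gt_eqF//.
by move: (N^-1) => Ni; rewrite /b; ring.
Qed.

End Pointwise.

(** * Frames of solutions *)

Local Opaque derive1.

(** The last hypothesis reads [L^T S^T L = L^T S L]: the columns of [(U; L)] span a Lagrangian
    subspace. *)
Lemma sym_of_mulmx (K : comUnitRingType) n (S L U : 'M[K]_n) : L \in unitmx ->
  S *m L = U -> U^T *m L = L^T *m U -> S^T = S.
Proof.
move=> lo <-; rewrite trmx_mul mulmxA => /(congr1 (mulmx^~ (invmx L))).
rewrite !mulmxK// => /(congr1 (mulmx (invmx L^T))).
by rewrite !mulKmx// unitmx_tr.
Qed.

(** A linear action on the pair [(up; lo)] is a Moebius action on [up lo^-1]. The matrix [C T + D]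
    is invertible as a left factor of [lo']. *)
Lemma moebius_quotient (K : comUnitRingType) n
    (A B C D T T' lo lo' up up' : 'M[K]_n) :
  lo \in unitmx -> lo' \in unitmx -> T *m lo = up -> T' *m lo' = up' ->
  up' = A *m up + B *m lo -> lo' = C *m up + D *m lo ->
  [/\ C *m T + D \in unitmx, lo' = (C *m T + D) *m lo &
      T' *m (C *m T + D) = A *m T + B].
Proof.
move=> ulo ulo' <- Tlo'; rewrite !mulmxA -!mulmxDl => upE loE.
have uJ : C *m T + D \in unitmx.
  by move: ulo'; rewrite loE unitmx_mul => /andP[].
split=> //; have : T' *m (C *m T + D) *m lo = (A *m T + B) *m lo.
  by rewrite -mulmxA -loE Tlo'.
by move=> /(congr1 (mulmx^~ (invmx lo))); rewrite !mulmxK.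
Qed.

Section Frames.
Variable R : realType.
Local Notation C := (Cx R).
Local Notation conjmx := Defs.conjmx.

Definition upmx (v : frame R) (x : C) : 'M[C]_2 :=
  mx2 (v 3 x) (derive1 (v 3) x) (v 2 x) (derive1 (v 2) x).

Definition lomx (v : frame R) (x : C) : 'M[C]_2 :=
  mx2 (v 1 x) (derive1 (v 1) x) (v 0 x) (derive1 (v 0) x).

Lemma det_mx2 (p q r s : C) : \det (mx2 p q r s) = p * s - q * r.
Proof. by rewrite det_mx22 !mxE. Qed.

(** The two sides are transposes of each other, so their difference is antisymmetric of size 2. Its
    only independent entry is, up to sign, the sum of two Wronskians in the hypothesis. *)
Lemma mx2_tr_mul_sym (p q r s p' q' r' s' : C) :
  r * s' - s * r' + (p * q' - q * p') = 0 ->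
  (mx2 p' q' r' s')^T *m mx2 p q r s = (mx2 p q r s)^T *m mx2 p' q' r' s'.
Proof.
move=> h; have {}h : p * q' + r * s' = q * p' + s * r'.
  by apply/eqP; rewrite -subr_eq0 -h; apply/eqP; ring.
apply: eq_mx22; rewrite !(mxE, big_ord2) /=.
- by rewrite mulrC [r' * _]mulrC.
- by rewrite h mulrC [r' * _]mulrC.
- by rewrite mulrC [s' * _]mulrC h.
- by rewrite mulrC [s' * _]mulrC.
Qed.

Lemma det_lomx v x : \det (lomx v x) = - W (v 0) (v 1) x.
Proof. by rewrite det_mx2 /W opprB; congr (_ - _); exact: mulrC. Qed.

Lemma lomx_unit C0 v x : w C0 v 0 1 x != 0 -> lomx v x \in unitmx.
Proof.
by rewrite /w mulf_eq0 negb_or unitmxE unitfE det_lomx oppr_eq0 => /andP[].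
Qed.

Lemma Tmx_lomx v x : lomx v x \in unitmx -> Tmx v x *m lomx v x = upmx v x.
Proof. by move=> lo; rewrite /Tmx -/(upmx v x) -/(lomx v x) mulmxKV. Qed.

Lemma col_lomx v x : col 0 (lomx v x) = col2 v x.
Proof. by apply/matrixP => i j; rewrite !mxE; case: (ord2P i) => ->. Qed.

Lemma Tmx_col2 v x : lomx v x \in unitmx ->
  Tmx v x *m col2 v x = \col_i [:: v 3 x; v 2 x]`_i.
Proof.
move=> lo; rewrite -col_lomx colE mulmxA Tmx_lomx// -colE.
by apply/matrixP => i j; rewrite !mxE; case: (ord2P i) => ->.
Qed.

Lemma Tmx_sym v x : lomx v x \in unitmx ->
  W (v 0) (v 2) x + W (v 1) (v 3) x = 0 -> (Tmx v x)^T = Tmx v x.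
Proof.
move=> lo hW; apply: (sym_of_mulmx _ _ _ _ _ lo (Tmx_lomx _ _ lo)).
by rewrite /W in hW; rewrite /upmx /lomx; apply: mx2_tr_mul_sym.
Qed.

(** First-order jet of [(u_3, u_2, u_1, u_0)^t]; [rev_ord] follows the ordering used by [col4] and
    [act]. *)
Definition stackmx (v : frame R) (x : C) : 'M[C]_(2 + 2, 2) :=
  \matrix_(i, k) [:: v (rev_ord i) x; derive1 (v (rev_ord i)) x]`_k.

Lemma stackmxE v x : stackmx v x = col_mx (upmx v x) (lomx v x).
Proof.
rewrite -[LHS]vsubmxK; congr col_mx; apply/matrixP => i k; rewrite !mxE.
  case: (ord2P i) => ->.
    by have -> : rev_ord (lshift 2 (0 : 'I_2)) = 3 :> 'I_4 by apply: val_inj.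
  by have -> : rev_ord (lshift 2 (1 : 'I_2)) = 2 :> 'I_4 by apply: val_inj.
case: (ord2P i) => ->.
  by have -> : rev_ord (rshift 2 (0 : 'I_2)) = 1 :> 'I_4 by apply: val_inj.
by have -> : rev_ord (rshift 2 (1 : 'I_2)) = 0 :> 'I_4 by apply: val_inj.
Qed.

Lemma derive_lincomb n (k : 'I_n -> C) (f : 'I_n -> C -> C) (x : C) :
  (forall i, derivable (f i) x 1) ->
  derivable (fun z => \sum_i k i * f i z : C) x 1 /\
  derive1 (fun z => \sum_i k i * f i z : C) x = \sum_i k i * derive1 (f i) x.
Proof.
move=> df; have -> : (fun z => \sum_i k i * f i z) = \sum_i (k i \*: f i).
  by apply/funext => z; rewrite fct_sumE.
split; first by apply: derivable_sum => i; exact: derivableZ.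
rewrite derive1E derive_sum => [|i]; last exact: derivableZ.
by apply: eq_bigr => i _; rewrite derive1E; exact: (deriveZ _ (df i)).
Qed.

Lemma actE (M : 'M[C]_(2 + 2)) (v : frame R) j :
  act M v j = fun z => \sum_i M (rev_ord j) i * v (rev_ord i) z.
Proof.
by apply/funext => z; rewrite /act !mxE; apply: eq_bigr => i _; rewrite !mxE.
Qed.

(** The entries of [M] are constants, so the action commutes with differentiation. *)
Lemma stackmx_act (M : 'M[C]_(2 + 2)) (v : frame R) (x : C) :
  (forall j, derivable (v j : C -> C) x 1) ->
  stackmx (act M v) x = M *m stackmx v x.
Proof.
move=> dv; apply/matrixP => i k; rewrite !mxE actE rev_ordK.
case: (ord2P k) => -> /=.
  by apply: eq_bigr => j _; rewrite !mxE.
rewrite (proj2 (derive_lincomb _ _ _ _ _)) => [|j]; last exact: dv.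
by apply: eq_bigr => j _; rewrite !mxE.
Qed.

Lemma Sp4_block (K : comPzRingType) (A B C D : 'M[K]_2) :
  Sp4 (block_mx A B C D) -> [/\ A^T *m C = C^T *m A, B^T *m D = D^T *m B &
    A^T *m D - C^T *m B = 1%:M].
Proof.
rewrite /Sp4 /Jmx /= tr_block_mx !mulmx_block.
rewrite !(mulmx0, mulmx1, mulmxN, add0r, addr0, mulNmx).
move=> /eq_block_mx[h1 h2 _ h4]; split.
- by apply/eqP; rewrite -subr_eq0 addrC h1.
- by apply/eqP; rewrite -subr_eq0 addrC h4.
- by rewrite addrC.
Qed.

Lemma toC_block (A B C' D : 'M[R]_2) :
  toC (block_mx A B C' D) = block_mx (toC A) (toC B) (toC C') (toC D).
Proof. exact: map_block_mx. Qed.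

Lemma Sp4_toC (g : 'M[R]_(2 + 2)) : Sp4 g -> Sp4 (toC g).
Proof.
rewrite /Sp4 /= => hg.
have JE : toC (Jmx R) = Jmx C.
  by rewrite toC_block /toC !map_mxN !map_mx1 !map_mx0.
by rewrite -JE /toC map_trmx -!map_mxM hg.
Qed.

Lemma Zmx_act (A B C' D : 'M[R]_2) (C0 : C) (v : frame R) (x : C)
    (gv := act (toC (block_mx A B C' D)) v) :
  Sp4 (block_mx A B C' D) -> (forall j, derivable (v j : C -> C) x 1) ->
  W (v 0) (v 2) x + W (v 1) (v 3) x = 0 ->
  Z_defined C0 v x -> Z_defined C0 gv x ->
  [/\ cocycle C' D (Zmx v x) \in unitmx,
      Zmx gv x = siegel_act A B C' D (Zmx v x) &
      phi gv x * (w C0 gv 0 1 x)^* =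
      \det (cocycle C' D (Zmx v x)) * (phi v x * (w C0 v 0 1 x)^*)].
Proof.
move=> sp dv hW [w0 phi0] [gw0 gphi0].
have := Sp4_toC _ sp; rewrite toC_block => /Sp4_block[hAC hBD hAD].
have lo := lomx_unit _ _ _ w0; have glo := lomx_unit _ _ _ gw0.
have symT := Tmx_sym _ _ lo hW.
have Tlo := Tmx_lomx _ _ lo; have gTlo := Tmx_lomx _ _ glo.
have : stackmx gv x =
    block_mx (toC A) (toC B) (toC C') (toC D) *m stackmx v x.
  by rewrite -toC_block; exact: stackmx_act.
rewrite !stackmxE mul_block_col => /eq_col_mx[gupE gloE].
clearbody gv.
have [uJ loE gT] := moebius_quotient _ _ _ _ _ _ _ _ _ _ _ _
  lo glo Tlo gTlo gupE gloE.
set J := toC C' *m Tmx v x + toC D in uJ loE gT.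
(* The blocks are real, so [conj T] obeys the same Moebius formula as [T], with cocycle the
   conjugate of [J]. *)
have conjM (P Q : 'M[R]_2) (S : 'M[C]_2) :
    toC P *m conjmx S + toC Q = conjmx (toC P *m S + toC Q).
  rewrite !conjmxE map_mxD map_mxM; congr (_ *m _ + _);
  by rewrite -conjmxE conjmx_toC.
have symTb : (conjmx (Tmx v x))^T = conjmx (Tmx v x).
  by rewrite !conjmxE map_trmx symT.
have uJb : toC C' *m conjmx (Tmx v x) + toC D \in unitmx.
  by rewrite conjM conjmxE map_unitmx.
have gTb : conjmx (Tmx gv x) *m (toC C' *m conjmx (Tmx v x) + toC D) =
    toC A *m conjmx (Tmx v x) + toC B.
  by rewrite !conjM -gT -/J; apply/esym; exact: map_mxM.
have gcol : col2 gv x = J *m col2 v x.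
  by rewrite -!col_lomx loE !colE mulmxA.
have c0 : 2 * 'i%C != 0 :> C.
  by rewrite mulf_neq0 ?pnatr_eq0// eq_complex /= oner_eq0 andbF.
have detE : phi v x * \det (cocycle C' D (Zmx v x)) =
    phi gv x * \det (toC C' *m conjmx (Tmx v x) + toC D).
  exact: (det_cocycle_mod _ _ _ _ _ _ hAC hBD hAD _ _ _ _ _ _ _ _ _
    c0 symT symTb uJ uJb gT gTb (sub_conjmx _ _ _ _) (sub_conjmx _ _ _ _) gcol).
have modE : Zmx gv x *m cocycle C' D (Zmx v x) = toC A *m Zmx v x + toC B.
  exact: (moebius_mod _ _ _ _ _ _ hAC hBD hAD _ _ _ _ _ _ _ _ _
    c0 symT symTb uJ uJb gT gTb (sub_conjmx _ _ _ _) (sub_conjmx _ _ _ _) gcol).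
(* In [detE] both factors on the right are nonzero, hence so is the determinant on the left. *)
have uZ : cocycle C' D (Zmx v x) \in unitmx.
  rewrite unitmxE unitfE; apply: contra_neq gphi0 => d0.
  move: detE; rewrite d0 mulr0 => /esym/eqP; rewrite mulf_eq0 => /orP[/eqP//|].
  by move: uJb; rewrite unitmxE unitfE => /negPf ->.
split; [exact: uZ | by rewrite /siegel_act -modE mulmxK |].
have -> : w C0 gv 0 1 x = \det J * w C0 v 0 1 x.
  have hdet u y : w C0 u 0 1 y = - C0 * \det (lomx u y).
    by rewrite det_lomx mulrNN.
  by rewrite !hdet loE det_mulmx mulrCA.
rewrite rmorphM/= mulrA [RHS]mulrA; congr (_ * _).
by rewrite [RHS]mulrC detE conjM conjmxE det_map_mx.
Qed.

End Frames.

(** * Analytic continuation *)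

Section Continuation.
Variable R : realType.
Local Notation C := (Cx R).

(** The equality is claimed near [x], not only at [x], so that the induction can differentiate it
    once more. *)
Lemma derive1n_lincomb n (k : 'I_n -> C) (f : 'I_n -> C -> C) m (x : C) :
  (\forall z \near x, forall i l, (l < m)%N ->
     derivable (derive1n l (f i) : C -> C) z 1) ->
  \forall z \near x, derive1n m (fun z => \sum_i k i * f i z : C) z =
     \sum_i k i * derive1n m (f i) z.
Proof.
elim: m x => [|m IH] x df; first exact: filterE.
apply: filterS (near_join df) => z dz; rewrite derive1nS.
have E : \forall y \near z, derive1n m (fun z => \sum_i k i * f i z : C) y =
     \sum_i k i * derive1n m (f i) y.
  by apply: IH; apply: filterS dz => y dy i l lm; apply: dy; exact: ltnW.
rewrite derive1E (near_eq_derive _ E) -derive1E.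
apply: (proj2 (derive_lincomb _ _ _ _ _ _)) => i.
by have := nbhs_singleton dz; apply.
Qed.

Lemma solution_lincomb (a : 'I_5 -> {poly C}) n (k : 'I_n -> C)
    (f : 'I_n -> C -> C) (x : C) :
  (forall i, solution a x (f i)) ->
  solution a x (fun z => \sum_i k i * f i z).
Proof.
move=> /filter_forall sf.
have df m : (m <= 4)%N -> \forall z \near x, forall i l, (l < m)%N ->
    derivable (derive1n l (f i) : C -> C) z 1.
  move=> m4; apply: filterS sf => z sf i l lm.
  by apply: (sf i).1; exact: leq_trans m4.
(* The nested neighbourhood is needed because derivability at [z] is transferred along an equality
   valid near [z]. *)
have /filter_forall E (m : 'I_5) : \forall z \near x,
    \forall y \near z, derive1n m (fun z => \sum_i k i * f i z : C) y =
     \sum_i k i * derive1n m (f i) y.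
  apply: near_join; apply: derive1n_lincomb.
  by apply: (df m); rewrite -ltnS.
apply: filterS2 sf E => z sfz Ez.
split=> [m m4|].
  have m5 : (m < 5)%N by exact: ltnW.
  have [d _] := derive_lincomb R n k _ z (fun i => (sfz i).1 m m4).
  apply: near_eq_derivable d.
  by apply: filterS (Ez (Ordinal m5)) => y /esym.
transitivity (\sum_i k i * \sum_(l < 5) (a l).[z] * derive1n l (f i) z).
  under [RHS]eq_bigr do rewrite mulr_sumr.
  rewrite exchange_big; apply: eq_bigr => l _ /=.
  rewrite (nbhs_singleton (Ez l)) mulr_sumr.
  by apply: eq_bigr => i _; rewrite mulrCA.
by rewrite big1// => i _; rewrite (sfz i).2 mulr0.
Qed.

Lemma solution_act (a : 'I_5 -> {poly C}) M (v : frame R) (x : C) :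
  (forall j, solution a x (v j)) -> forall j, solution a x (act M v j).
Proof. by move=> sv j; rewrite actE; exact: solution_lincomb. Qed.

Lemma germ_eq_sym (x : C) (f g : frame R) : germ_eq x f g -> germ_eq x g f.
Proof. by move=> fg j; apply: filterS (fg j) => z ->. Qed.

Lemma germ_eq_trans (x : C) (f g h : frame R) :
  germ_eq x f g -> germ_eq x g h -> germ_eq x f h.
Proof. by move=> fg gh j; apply: filterS2 (fg j) (gh j) => z -> ->. Qed.

Lemma germ_eq_near (x : C) (f g : frame R) :
  germ_eq x f g -> \forall z \near x, germ_eq z f g.
Proof.
move=> fg; have /filter_forall// : forall j, \forall z \near x,
  \forall y \near z, f j y = g j y by move=> j; exact: near_join (fg j).
Qed.

Lemma germ_eq_act M (x : C) (f g : frame R) :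
  germ_eq x f g -> germ_eq x (act M f) (act M g).
Proof.
move=> /filter_forall fg j; apply: filterS fg => z fg.
by rewrite !actE; apply: eq_bigr => i _; rewrite fg.
Qed.

Lemma continuation_act (a : 'I_5 -> {poly C}) c M (f g : frame R) :
  continuation a c f g -> continuation a c (act M f) (act M g).
Proof.
move=> [cc reg [F [sF nF F0 F1]]]; split=> //; exists (fun t => act M (F t)).
split=> [t /sF|t /nF||]; [exact: solution_act | | exact: germ_eq_act..].
by apply: filterS => s h /h; exact: germ_eq_act.
Qed.

Lemma continuation_derivable (a : 'I_5 -> {poly C}) c (f g : frame R) :
  continuation a c f g -> forall j, derivable (g j : C -> C) (c 1) 1.
Proof.
move=> [_ _ [F [sF _ _ F1]]] j.
have I1 : (1 : R) \in `[0, 1] by rewrite in_itv/= ler01 lexx.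
apply: near_eq_derivable (F1 j) _.
by have [/(_ 0) h _] := nbhs_singleton (sF _ I1 j); exact: h.
Qed.

Lemma near_affine (k m t : R) (P : set R) :
  (\forall y \near k * t + m, P y) -> \forall s \near t, P (k * s + m).
Proof.
move=> hP; have : {for t, continuous (fun s : R => k * s + m)}.
  by apply: cvgD; [apply: cvgM; [exact: cvg_cst|exact: cvg_id]|exact: cvg_cst].
by apply.
Qed.

(** Locality for a property given separately on the two halves of a concatenated path. At [t = 2^-1]
    both hypotheses apply, one on each side; the strict inequality matches the test in [concat]. *)
Lemma near_concat (t : R) (P Q : set R) :
  (t <= 2^-1 -> \forall y \near 2 * t, y \in `[0, 1] -> P y) ->
  (2^-1 <= t -> \forall y \near 2 * t - 1, y \in `[0, 1] -> Q y) ->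
  \forall s \near t, s \in `[0, 1] ->
    (s <= 2^-1 -> P (2 * s)) /\ (2^-1 < s -> Q (2 * s - 1)).
Proof.
move=> hP hQ.
have {}hP : t <= 2^-1 ->
    \forall s \near t, s \in `[0, 1] -> s <= 2^-1 -> P (2 * s).
  move=> /hP; rewrite -[2 * t]addr0 => /near_affine; apply: filterS => s hs.
  rewrite in_itv/= => /andP[s0 s1] s2; rewrite -[2 * s]addr0; apply: hs.
  by rewrite in_itv/=; apply/andP; split; lra.
have {}hQ : 2^-1 <= t ->
    \forall s \near t, s \in `[0, 1] -> 2^-1 < s -> Q (2 * s - 1).
  move=> /hQ /near_affine; apply: filterS => s hs.
  rewrite in_itv/= => /andP[s0 s1] s2; apply: hs.
  by rewrite in_itv/=; apply/andP; split; lra.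
have [t2|t2|t2] := ltgtP t 2^-1.
- apply: filterS2 (hP (ltW t2)) (lt_nbhsl t2) => s Ps s2 s01.
  by split=> [|/(lt_trans s2)]; [exact: Ps | rewrite ltxx].
- apply: filterS2 (hQ (ltW t2)) (lt_nbhsr t2) => s Qs s2 s01.
  by split=> [/(lt_le_trans s2)|]; [rewrite ltxx | exact: Qs].
- have t2' : 2^-1 <= t by rewrite t2.
  have t2'' : t <= 2^-1 by rewrite t2.
  apply: filterS2 (hP t2'') (hQ t2') => s Ps Qs s01.
  by split; [exact: Ps | exact: Qs].
Qed.

(** Polymorphic because it joins both paths in [C] and families of germs over them. The midpoint
    takes its value from [f]. *)
Definition concat (T : Type) (f g : R -> T) (t : R) : T :=
  if t <= 2^-1 then f (2 * t) else g (2 * t - 1).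

Lemma concat0 T (f g : R -> T) : concat T f g 0 = f 0.
Proof. by rewrite /concat invr_ge0 ler0n mulr0. Qed.

Lemma concat1 T (f g : R -> T) : concat T f g 1 = g 1.
Proof.
have /negPf lt21 : ~~ (1 <= 2^-1 :> R) by rewrite -ltNge; lra.
by rewrite /concat lt21 mulr1; congr g; ring.
Qed.

Lemma continuation_concat (a : 'I_5 -> {poly C}) c d (f g h : frame R) :
  c 1 = d 0 -> continuation a c f g -> continuation a d g h ->
  continuation a (concat C c d) f h.
Proof.
move=> cd [cc creg [F [sF nF F0 F1]]] [dc dreg [G [sG nG G0 G1]]].
have in1 (t : R) : t \in `[0, 1] -> t <= 2^-1 -> 2 * t \in `[0, 1].
  by rewrite !in_itv/= => /andP[? ?] ?; apply/andP; split; lra.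
have in2 (t : R) : t \in `[0, 1] -> 2^-1 <= t -> 2 * t - 1 \in `[0, 1].
  by rewrite !in_itv/= => /andP[? ?] ?; apply/andP; split; lra.
have I0 : (0 : R) \in `[0, 1] by rewrite in_itv/= ler01 lexx.
have cont (p : R -> C) : {within `[0, 1], continuous p} ->
    forall t : R, t \in `[0, 1] -> forall P, nbhs (p t) P ->
    \forall s \near t, s \in `[0, 1] -> P (p s).
  move=> /subspace_continuousP pc t t01 P hP.
  exact: (pc t t01 P hP).
have concatL (t : R) : t <= 2^-1 -> concat C c d t = c (2 * t).
  by move=> t2; rewrite /concat t2.
have concatR (t : R) : 2^-1 <= t -> concat C c d t = d (2 * t - 1).
  rewrite /concat le_eqVlt => /predU1P[<-|t2]; last by rewrite leNgt t2.
  by rewrite lexx mulfV ?pnatr_eq0// subrr cd.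
split.
- apply/subspace_continuousP => t t01 P hP.
  have Pc : t <= 2^-1 -> \forall y \near 2 * t, y \in `[0, 1] -> P (c y).
    by move=> t2; apply: (cont c cc _ (in1 _ t01 t2) P); rewrite -concatL.
  have Pd : 2^-1 <= t -> \forall y \near 2 * t - 1, y \in `[0, 1] -> P (d y).
    by move=> t2; apply: (cont d dc _ (in2 _ t01 t2) P); rewrite -concatR.
  apply: filterS (near_concat _ _ _ Pc Pd) => s hs s01; have [h1 h2] := hs s01.
  change (P (concat C c d s)); have [s2|s2] := leP s 2^-1.
    by rewrite concatL//; exact: h1.
  by rewrite concatR ?ltW//; exact: h2.
- move=> t t01; rewrite /concat; case: leP => t2; [apply: creg|apply: dreg].
    exact: in1.
  by apply: in2 => //; exact: ltW.
exists (concat (frame R) F G); split.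
- move=> t t01; rewrite /concat; case: leP => t2; [apply: sF|apply: sG].
    exact: in1.
  by apply: in2 => //; exact: ltW.
- move=> t t01.
  have Fc : t <= 2^-1 -> \forall y \near 2 * t, y \in `[0, 1] ->
      germ_eq (c y) (F y) (concat (frame R) F G t).
    by move=> t2; rewrite /concat t2; apply: nF; exact: in1.
  have Gd : 2^-1 <= t -> \forall y \near 2 * t - 1, y \in `[0, 1] ->
      germ_eq (d y) (G y) (concat (frame R) F G t).
    rewrite le_eqVlt => /predU1P[t2|t2]; last first.
      by rewrite /concat leNgt t2 /=; apply: nG; apply: in2 => //; exact: ltW.
    rewrite /concat -t2 lexx mulfV ?pnatr_eq0// subrr.
    (* At the midpoint the family has value [F 1], but its right-hand neighbours come from [G]. Both
       [F 1] and [G 0] represent [g] there, and this equality of germs spreads to nearby [d s] by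
       continuity of [d]. *)
    have GF : germ_eq (d 0) (G 0) (F 1).
      by apply: germ_eq_trans G0 (germ_eq_sym _ _ _ _); rewrite -cd.
    have := cont _ dc _ I0 _ (germ_eq_near _ _ _ GF).
    apply: filterS2 (nG _ I0) => s Gs GFs s01.
    exact: germ_eq_trans (Gs s01) (GFs s01).
  apply: filterS (near_concat _ _ _ Fc Gd) => s hs s01; have [h1 h2] := hs s01.
  rewrite [concat _ _ _ s]/concat [concat _ F _ s]/concat.
  by case: (leP s) => s2; [exact: h1 | exact: h2].
- by rewrite !concat0.
- by rewrite !concat1.
Qed.

(** The loop is run first, turning [u] into [M u]; the path that leads from [u] to [v] then leads
    from [M u] to [M v]. *)
Lemma branches_act (a : 'I_5 -> {poly C}) z0 (u v : frame R) x M :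
  monodromy a z0 u M -> branches a z0 u (x, v) -> branches a z0 u (x, act M v).
Proof.
move=> [l [l0 l1 lu]] [c /= [c0 c1 cu]].
exists (concat C l c); split=> /=.
- by rewrite !concat0.
- by rewrite !concat1.
- by apply: continuation_concat lu (continuation_act _ _ _ _ _ cu); rewrite l1.
Qed.

End Continuation.

(** A function of [Z] is encoded by maps [zf] and [F] on matrices that reproduce [z] and
    [phi conj(w_01)] on a set [Om] of branches. Monodromy changes the frame and keeps the base point
    [x]. *)
Theorem theorem2 (R : realType) (a : 'I_5 -> {poly Cx R}) (z0 : Cx R)
    (u : frame R) (C0 : Cx R)
    (ha : fuchsian a)
    (hz0 : regular_pt a z0)
    (hu : basis_of_solutions a z0 u)
    (hW : forall x v, branches a z0 u (x, v) ->
       W (v 0) (v 2) x + W (v 1) (v 3) x = 0)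
    (hSp : monodromy a z0 u `<=` @toC R (2 + 2) (2 + 2) @` @Sp4 R)
    (hcomm : exists H : set 'M[R]_(2 + 2),
       [/\ matrix_group H,
           H `<=` (fun g : 'M[int]_(2 + 2) => map_mx intr g) @` @Sp4 int &
           commensurable (Gamma a z0 u) H])
    (hMUM : has_MUM_point a z0 u)
    (hC0 : C0 != 0) :
  [/\ forall (A B C D : 'M[R]_2), Gamma a z0 u (block_mx A B C D) ->
        forall (x : Cx R) (v : frame R), branches a z0 u (x, v) ->
        let gv := act (toC (block_mx A B C D)) v in
        branches a z0 u (x, gv) /\
        (Z_defined C0 v x -> Z_defined C0 gv x ->
         [/\ cocycle C D (Zmx v x) \in unitmx,
             Zmx gv x = siegel_act A B C D (Zmx v x) &
             phi gv x * (w C0 gv 0 1 x)^* =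
             \det (cocycle C D (Zmx v x)) * (phi v x * (w C0 v 0 1 x)^*)]),
      forall (Om : set (Cx R * frame R)) (zf F : 'M[Cx R]_2 -> Cx R),
        (forall x v, Om (x, v) ->
           [/\ branches a z0 u (x, v), Z_defined C0 v x,
               zf (Zmx v x) = x &
               F (Zmx v x) = phi v x * (w C0 v 0 1 x)^*]) ->
        forall (A B C D : 'M[R]_2), Gamma a z0 u (block_mx A B C D) ->
        forall (x : Cx R) (v : frame R),
        Om (x, v) -> Om (x, act (toC (block_mx A B C D)) v) ->
        zf (siegel_act A B C D (Zmx v x)) = zf (Zmx v x) /\
        F (siegel_act A B C D (Zmx v x)) =
          \det (cocycle C D (Zmx v x)) * F (Zmx v x)
    & forall (x : Cx R) (v : frame R), branches a z0 u (x, v) ->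
        w C0 v 0 1 x != 0 ->
        \det (Immx (Tmx v x)) < 0 ->
        0 < complex.Im (v 3 x * (v 1 x)^* + v 2 x * (v 0 x)^*) ->
        siegel_half_space (Zmx v x) ].
Proof.
have spG (A B C D : 'M[R]_2) :
    Gamma a z0 u (block_mx A B C D) -> Sp4 (block_mx A B C D).
  by move=> /hSp[g sp /toC_inj <-].
have transf (A B C D : 'M[R]_2) x v : Gamma a z0 u (block_mx A B C D) ->
    branches a z0 u (x, v) ->
    Z_defined C0 v x -> Z_defined C0 (act (toC (block_mx A B C D)) v) x ->
    [/\ cocycle C D (Zmx v x) \in unitmx,
        Zmx (act (toC (block_mx A B C D)) v) x = siegel_act A B C D (Zmx v x) &
        phi (act (toC (block_mx A B C D)) v) x *
          (w C0 (act (toC (block_mx A B C D)) v) 0 1 x)^* =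
        \det (cocycle C D (Zmx v x)) * (phi v x * (w C0 v 0 1 x)^*)].
  move=> hg br; apply: Zmx_act; [exact: spG | | exact: hW].
  have [c /= [_ c1 cu]] := br.
  by move=> j; rewrite -c1; exact: continuation_derivable cu j.
split.
- move=> A B C D hg x v br gv; split; first exact: branches_act.
  exact: transf.
- move=> Om zf F hOm A B C D hg x v Ov Ogv.
  have [br dv zv Fv] := hOm _ _ Ov; have [_ dgv zgv Fgv] := hOm _ _ Ogv.
  have [_ ZE phiE] := transf _ _ _ _ _ _ hg br dv dgv.
  move: (act _ _) ZE phiE zgv Fgv => gv ZE phiE zgv Fgv.
  (* Both branches lie over the same [x], so [zf] takes the value [x] at [Z] and at its image. *)
  have zE := etrans (congr1 zf (esym ZE)) (etrans zgv (esym zv)).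
  have FE := etrans (congr1 F (esym ZE)) (etrans Fgv phiE).
  by split; [exact zE | rewrite FE Fv].
- move=> x v br w0 indef pos; have lo := lomx_unit _ _ _ _ w0.
  apply: Zmx_siegel indef pos; last exact: Tmx_col2.
  exact: Tmx_sym lo (hW _ _ br).
Qed.
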